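(* Let $c\in\mathbb{E}^3$, $r>0$, let $x:U\to\mathbb{E}^3\setminus\{c\}$ be a regular patch and let $y=\Phi\circ x$ be its inverse patch, where $\Phi$ is the inversion with center $c$ and radius $r$. Then asymptotic vectors in $x$ are invariant under $\Phi_*$ if and only if $\eta=\langle U_x,x-c\rangle=0$. Precisely: let $(u,v)\in U$, $p=x(u,v)$, and let $v_p\in T_p(x)$ be an asymptotic vector of $x$. Then $\Phi_{*p}(v_p)$ is an asymptotic vector of $y$ if and only if $\eta(u,v)=0$.
   Context: $\mathbb{E}^3$ is Euclidean 3-space. The inversion with center $c$ and radius $r$ is $\Phi:\mathbb{E}^3\setminus\{c\}\to\mathbb{E}^3\setminus\{c\}$, $\Phi(p)=c+\frac{r^2}{\|p-c\|^2}(p-c)$, with tangent map $\Phi_{*p}(v_p)=\frac{r^2 v_p}{\|p-c\|^2}-\frac{2r^2\langle p-c,v_p\rangle}{\|p-c\|^4}(p-c)$. A regular patch is a smooth map $x:U\to\mathbb{E}^3\setminus\{c\}$, $U\subset\mathbb{R}^2$ open, with $x_u\times x_v\neq0$ everywhere; $y=\Phi\circ x$ is then also regular. At a parameter $(u,v)$, $T_p(x)=\mathrm{span}(x_u,x_v)$ with $p=x(u,v)$ (similarly for $y$ at $\Phi(p)$). The unit normals are $U_x=\frac{x_u\times x_v}{\|x_u\times x_v\|}$ and $U_y=\frac{y_u\times y_v}{\|y_u\times y_v\|}$. The shape operator $S$ of $x$ is the linear map with $S(x_u)=-\partial_uU_x$, $S(x_v)=-\partial_vU_x$; $I(a,b)=\langle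 a,b\rangle$, $II(a,b)=\langle Sa,b\rangle$. The normal curvature of $x$ in the direction of a nonzero tangent vector $a$ is $k(a)=\frac{II(a,a)}{I(a,a)}$; an asymptotic vector of $x$ is a nonzero tangent vector $a$ with $k(a)=0$. The corresponding objects for $y$ (using $U_y$) are defined likewise. The function $\eta$ is $\eta(u,v)=\langle U_x(u,v),x(u,v)-c\rangle$. *)

(* Defs.v *)
From HB Require Import structures.
From mathcomp Require Import all_boot all_order all_algebra.
From mathcomp Require Import all_classical all_reals all_analysis.
From mathcomp Require Import ring.
Set Implicit Arguments.
Unset Strict Implicit.
Unset Printing Implicit Defensive.
Import Order.TTheory GRing.Theory Num.Theory.
Import numFieldNormedType.Exports.
Local Open Scope classical_set_scope.
Local Open Scope ring_scope.

Section Euclidean3.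
Context {R : realType}.
Implicit Types a b : 'rV[R]_3.

Definition dotv a b : R := \sum_(i < 3) a 0 i * b 0 i.

(* The norm `|a| that the library puts on 'rV[R]_3 is the sup norm; it has the
   right topology but not the right values. *)
Definition enorm a : R := Num.sqrt (dotv a a).

Definition crossv a b : 'rV[R]_3 :=
  let a1 := a 0 0 in let a2 := a 0 1 in let a3 := a 0 2%:R in
  let b1 := b 0 0 in let b2 := b 0 1 in let b3 := b 0 2%:R in
  \row_(i < 3) [:: a2 * b3 - a3 * b2; a3 * b1 - a1 * b3; a1 * b2 - a2 * b1]`_i.

End Euclidean3.

Section Smooth.
Context {R : realType} {n : nat}.

Definition partial_u (f : R * R -> 'rV[R]_n) (q : R * R) : 'rV[R]_n := 'D_(1, 0) f q.
Definition partial_v (f : R * R -> 'rV[R]_n) (q : R * R) : 'rV[R]_n := 'D_(0, 1) f q.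

Fixpoint Ck_on (U : set (R * R)) (k : nat) (f : R * R -> 'rV[R]_n) : Prop :=
  (forall q, U q -> {for q, continuous f}) /\
  if k is k'.+1 then
    [/\ forall q, U q -> derivable f q (1, 0) /\ derivable f q (0, 1),
        Ck_on U k' (partial_u f) & Ck_on U k' (partial_v f)]
  else True.

Definition smooth_on (U : set (R * R)) (f : R * R -> 'rV[R]_n) : Prop :=
  forall k, Ck_on U k f.

End Smooth.

Section Inversion.
Context {R : realType}.
Implicit Types (c p : 'rV[R]_3) (r : R).

(* Total: the junk value at p = c is c. *)
Definition inversion c r p : 'rV[R]_3 :=
  c + (r ^+ 2 / enorm (p - c) ^+ 2) *: (p - c).

(* The velocity at t = 0 of t |-> inversion c r (p + t w);
   see inversion_tangentE for the closed form. *)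
Definition inversion_tangent c r p (w : 'rV[R]_3) : 'rV[R]_3 :=
  'D_w (inversion c r) p.

End Inversion.

(* x is a total function, of which only the restriction to the open set U is
   constrained; the definitions below are local, so they are meaningful at the
   points of U. *)
Section Patch.
Context {R : realType}.
Implicit Types (x : R * R -> 'rV[R]_3) (q : R * R) (a b : 'rV[R]_3).

Definition regular_patch (c : 'rV[R]_3) (U : set (R * R)) x : Prop :=
  [/\ open U, smooth_on U x, forall q, U q -> x q != c
    & forall q, U q -> crossv (partial_u x q) (partial_v x q) != 0].

Definition tangent_plane x q : {vspace 'rV[R]_3} :=
  <<[:: partial_u x q; partial_v x q]>>%VS.

Definition unit_normal x q : 'rV[R]_3 :=
  let n := crossv (partial_u x q) (partial_v x q) in (enorm n)^-1 *: n.

(* coord [tuple x_u; x_v] i a is the i-th coordinate of a in the basis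
   (x_u, x_v) of the tangent plane, so that the operator maps x_u and x_v to
   minus the partial derivatives of the unit normal (shape_operator_u,
   shape_operator_v). Its values off the tangent plane are irrelevant. *)
Definition shape_operator x q a : 'rV[R]_3 :=
  let B := [tuple partial_u x q; partial_v x q] in
  coord B 0 a *: (- partial_u (unit_normal x) q)
  + coord B 1 a *: (- partial_v (unit_normal x) q).

Definition first_form a b : R := dotv a b.

Definition second_form x q a b : R := dotv (shape_operator x q a) b.

Definition normal_curvature x q a : R :=
  second_form x q a a / first_form a a.

Definition asymptotic_vector x q a : Prop :=
  [/\ a \in tangent_plane x q, a != 0 & normal_curvature x q a = 0].

Definition eta (c : 'rV[R]_3) x q : R := dotv (unit_normal x q) (x q - c).

End Patch.

Section Facts.
Context {R : realType}.
Implicit Types (c p w a b : 'rV[R]_3) (x : R * R -> 'rV[R]_3) (q : R * R).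

Lemma dotv_ge0 a : 0 <= dotv a a.
Proof. by apply: sumr_ge0 => i _; rewrite -expr2 sqr_ge0. Qed.

Lemma dotv_eq0 a : (dotv a a == 0) = (a == 0).
Proof.
apply/idP/eqP => [|->]; last by rewrite /dotv big1// => i _; rewrite mxE mul0r.
rewrite psumr_eq0 => [/allP a0|i _]; last by rewrite -expr2 sqr_ge0.
apply/rowP => i; rewrite mxE; apply/eqP.
by have := a0 i (mem_index_enum i); rewrite -expr2 sqrf_eq0.
Qed.

Lemma enorm_sqr a : enorm a ^+ 2 = dotv a a.
Proof. by rewrite sqr_sqrtr// dotv_ge0. Qed.

Lemma inversion_tangentE c r p w : p != c ->
  inversion_tangent c r p w =
    (r ^+ 2 / enorm (p - c) ^+ 2) *: w
    - (2%:R * r ^+ 2 * dotv (p - c) w / enorm (p - c) ^+ 4) *: (p - c).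
Proof.
move=> pc; have d0 : dotv (p - c) (p - c) != 0 by rewrite dotv_eq0 subr_eq0.
pose g i (y : 'rV[R]_3) : R := (y - c) 0 i.
have dg i : is_derive p w (g i) (w 0 i).
  have -> : g i = (fun y : 'rV[R]_3 => y 0 i : R) - cst (c 0 i).
    by apply/funext => y; rewrite /g !mxE.
  have dyi : is_derive p w (fun y : 'rV[R]_3 => y 0 i : R) (w 0 i).
    apply: DeriveDef; first exact/diff_derivable/differentiable_coord.
    have := derive_mx (@derivable_id R 'rV[R]_3 p w).
    by rewrite derive_id => /matrixP/(_ 0 i) ->; rewrite mxE.
  by apply: is_derive_eq; rewrite subr0.
pose n : 'rV[R]_3 -> R := \sum_(i < 3) (g i * g i).
have nE y : n y = dotv (y - c) (y - c) by rewrite /n /dotv fct_sumE.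
have dn : is_derive p w n (2%:R * dotv (p - c) w).
  apply: is_derive_eq; rewrite mulr_sumr; apply: eq_bigr => i _.
  by rewrite /g/= /GRing.scale/=; ring.
have np0 : n p != 0 by rewrite nE.
have dV : is_derive p w (fun y => (n y)^-1)
    (- (n p) ^- 2 * (2%:R * dotv (p - c) w)).
  apply: DeriveDef; first exact: derivableV.
  by rewrite deriveV// derive_val.
have dI i : is_derive p w (fun y => inversion c r y 0 i)
    (((r ^+ 2 / enorm (p - c) ^+ 2) *: w
    - (2%:R * r ^+ 2 * dotv (p - c) w / enorm (p - c) ^+ 4) *: (p - c)) 0 i).
  have -> : (fun y => inversion c r y 0 i) =
      cst (c 0 i) + cst (r ^+ 2) * (fun y => (n y)^-1) * g i.
    apply/funext => y; rewrite /inversion enorm_sqr -nE.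
    by rewrite -[RHS]/(c 0 i + r ^+ 2 * (n y)^-1 * g i y) /g !mxE.
  apply: is_derive_eq.
  have -> : enorm (p - c) ^+ 4 = n p ^+ 2.
    by rewrite nE -enorm_sqr -exprM.
  rewrite enorm_sqr -nE /g !mxE.
  rewrite /GRing.scale/= /cst/= -[(_ * _) p]/(r ^+ 2 * (n p)^-1).
  by field.
have dF : derivable (inversion c r) p w by apply/derivable_mxP => k i; rewrite ord1.
rewrite /inversion_tangent derive_mx//; apply/rowP => i.
by rewrite mxE derive_val.
Qed.

Lemma crossv_free a b : crossv a b != 0 -> free [:: a; b].
Proof.
have crossZ (k : R) : crossv (k *: b) b = 0 :> 'rV[R]_3.
  apply/rowP => -[[|[|[|//]]] ?]; rewrite !mxE/=; ring.
move=> ab0; rewrite free_cons seq1_free span_seq1; apply/andP; split.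
  by apply: contra_neqN ab0 => /vlineP[k ->].
apply: contra_neq ab0 => ->.
by apply/rowP => -[[|[|[|//]]] ?]; rewrite !mxE/= ?mulr0 subrr.
Qed.

Lemma shape_operator_u x q : crossv (partial_u x q) (partial_v x q) != 0 ->
  shape_operator x q (partial_u x q) = - partial_u (unit_normal x) q.
Proof.
move=> /crossv_free fB; rewrite /shape_operator.
set B := [tuple _; _].
have cB j : coord B j (partial_u x q) = (0 == j)%:R by exact: (coord_free 0).
by rewrite !cB scale1r scale0r addr0.
Qed.

Lemma shape_operator_v x q : crossv (partial_u x q) (partial_v x q) != 0 ->
  shape_operator x q (partial_v x q) = - partial_v (unit_normal x) q.
Proof.
move=> /crossv_free fB; rewrite /shape_operator.
set B := [tuple _; _].
have cB j : coord B j (partial_v x q) = (1 == j)%:R by exact: (coord_free 1).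
by rewrite !cB scale1r scale0r add0r.
Qed.

Lemma shape_operator_linear x q : linear (shape_operator x q).
Proof.
move=> k a b; rewrite /shape_operator; set B := [tuple _; _].
have cP i : coord B i (k *: a + b) = k * coord B i a + coord B i b.
  exact: linearP.
rewrite !cP; move: (coord B) (partial_u _ _) (partial_v _ _) => {cP B} C e f.
rewrite ![(_ + _) *: _]scalerDl [k *: (_ + _)]scalerDr ![k *: (_ *: _)]scalerA.
exact: addrACA.
Qed.

End Facts.

(* Main.v *)
(* Put w = x - c, s = <w, w> and let H be the reflection in the plane orthogonal
   to w. The tangent map of the inversion is (r^2 / s) H, and since reflections
   reverse cross products the normal of the inverse patch is
   U_y = - H U_x = - U_x + (2 eta / s) w.
   Differentiating this identity gives
   II_y(Phi_* a, Phi_* a) = - (r^2 / s) (II_x(a, a) + (2 eta / s) I(a, a)),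
   so that for an asymptotic vector a of x the left-hand side vanishes exactly
   when eta does. *)
Require Import Defs.
From mathcomp Require Import all_boot all_order all_algebra.
From mathcomp Require Import all_classical all_reals all_analysis.
From mathcomp Require Import ring.
Import Order.TTheory GRing.Theory Num.Theory.
Import numFieldNormedType.Exports.
Local Open Scope classical_set_scope.
Local Open Scope ring_scope.

Section DotCross.
Context {R : realType}.
Implicit Types (a b d w : 'rV[R]_3) (k : R).

Lemma dotvE a b : dotv a b = a 0 0 * b 0 0 + a 0 1 * b 0 1 + a 0 2%:R * b 0 2%:R.
Proof.
rewrite /dotv !big_ord_recl big_ord0 addr0 addrA.
by congr (_ + _ * _ + _ * _); congr (_ _ _); apply/val_inj.
Qed.

Lemma rowv3P a b :
  a 0 0 = b 0 0 -> a 0 1 = b 0 1 -> a 0 2%:R = b 0 2%:R -> a = b.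
Proof.
move=> a0 a1 a2; apply/rowP => -[[|[|[|//]]] i3].
- by rewrite (_ : Ordinal i3 = 0)//; exact/val_inj.
- by rewrite (_ : Ordinal i3 = 1)//; exact/val_inj.
- by rewrite (_ : Ordinal i3 = 2%:R)//; exact/val_inj.
Qed.

Lemma dotvC a b : dotv a b = dotv b a.
Proof. by rewrite !dotvE; ring. Qed.

Lemma dotvDl a b d : dotv (a + b) d = dotv a d + dotv b d.
Proof. by rewrite !dotvE !mxE; ring. Qed.

Lemma dotvZl k a b : dotv (k *: a) b = k * dotv a b.
Proof. by rewrite !dotvE !mxE; ring. Qed.

Lemma dotvNl a b : dotv (- a) b = - dotv a b.
Proof. by rewrite -scaleN1r dotvZl mulN1r. Qed.

Lemma dotvDr a b d : dotv d (a + b) = dotv d a + dotv d b.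
Proof. by rewrite dotvC dotvDl !(dotvC d). Qed.

Lemma dotvZr k a b : dotv b (k *: a) = k * dotv b a.
Proof. by rewrite dotvC dotvZl (dotvC b). Qed.

Lemma dotvNr a b : dotv b (- a) = - dotv b a.
Proof. by rewrite dotvC dotvNl (dotvC b). Qed.

Lemma dotv_crossl a b : dotv (crossv a b) a = 0.
Proof. by rewrite dotvE !mxE/=; ring. Qed.

Lemma dotv_crossr a b : dotv (crossv a b) b = 0.
Proof. by rewrite dotvE !mxE/=; ring. Qed.

Lemma crossvZ k a b : crossv (k *: a) (k *: b) = k ^+ 2 *: crossv a b.
Proof. by apply: rowv3P; rewrite !mxE/=; ring. Qed.

Lemma enormZ k a : 0 <= k -> enorm (k *: a) = k * enorm a.
Proof.
move=> k0; rewrite /enorm dotvZl dotvZr mulrA -expr2 sqrtrM ?sqr_ge0//.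
by rewrite sqrtr_sqr ger0_norm.
Qed.

Lemma enorm_eq0 a : (enorm a == 0) = (a == 0).
Proof. by rewrite -dotv_eq0 -enorm_sqr expf_eq0. Qed.

Definition reflect_along w a : 'rV[R]_3 := a - (2%:R * dotv w a / dotv w w) *: w.

Lemma dotv_reflect w a b : w != 0 ->
  dotv (reflect_along w a) (reflect_along w b) = dotv a b.
Proof.
rewrite -dotv_eq0 => w0; rewrite /reflect_along.
rewrite !(dotvDl, dotvDr, dotvNl, dotvNr, dotvZl, dotvZr) (dotvC a w).
by field.
Qed.

Lemma reflect_alongZ w k a : reflect_along w (k *: a) = k *: reflect_along w a.
Proof. by rewrite /reflect_along dotvZr scalerBr scalerA !mulrA (mulrC 2%:R k). Qed.

Lemma reflect_alongN w a : reflect_along w (- a) = - reflect_along w a.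
Proof. by rewrite -scaleN1r reflect_alongZ scaleN1r. Qed.

Lemma reflect_along_eq0 w a : w != 0 -> (reflect_along w a == 0) = (a == 0).
Proof. by move=> w0; rewrite -dotv_eq0 dotv_reflect// dotv_eq0. Qed.

Lemma enorm_reflect w a : w != 0 -> enorm (reflect_along w a) = enorm a.
Proof. by move=> w0; rewrite /enorm dotv_reflect. Qed.

Lemma crossv_reflect w a b : w != 0 ->
  crossv (reflect_along w a) (reflect_along w b) = - reflect_along w (crossv a b).
Proof.
rewrite -dotv_eq0 !dotvE => w0.
by apply: rowv3P; rewrite !mxE/= !dotvE !mxE/=; field.
Qed.

Lemma normalize_crossv_reflect w k a b : w != 0 -> 0 < k ->
  let n := crossv (k *: reflect_along w a) (k *: reflect_along w b) in
  (enorm n)^-1 *: n =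
    - reflect_along w ((enorm (crossv a b))^-1 *: crossv a b).
Proof.
move=> w0 k0 n.
have -> : n = k ^+ 2 *: reflect_along w (- crossv a b).
  by rewrite /n crossvZ crossv_reflect// reflect_alongN.
rewrite enormZ ?sqr_ge0// enorm_reflect// scalerA invfM mulrAC mulVf ?mul1r; last first.
  by rewrite expf_eq0 gt_eqF.
have -> : enorm (- crossv a b) = enorm (crossv a b).
  by rewrite /enorm dotvNl dotvNr opprK.
by rewrite reflect_alongZ reflect_alongN scalerN.
Qed.

(* The derivative of - U + (2 e / <w, w>) w, where e = <U, w>, in a direction along
   which U and w have derivatives dU and dx with <U, dx> = 0. *)
Definition inverse_normal_derivative w e dx dU : 'rV[R]_3 :=
  - dU + (2%:R * dotv dU w / dotv w w - 4%:R * e * dotv w dx / dotv w w ^+ 2) *: w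
  + (2%:R * e / dotv w w) *: dx.

Lemma inverse_normal_derivative_comb w e k l (xu xv Uu Uv : 'rV[R]_3) :
  k *: inverse_normal_derivative w e xu Uu + l *: inverse_normal_derivative w e xv Uv
  = inverse_normal_derivative w e (k *: xu + l *: xv) (k *: Uu + l *: Uv).
Proof.
rewrite /inverse_normal_derivative !(dotvDl, dotvDr, dotvZl, dotvZr).
by apply/rowP => i; rewrite !mxE; ring.
Qed.

Lemma dotv_inverse_normal_derivative w e a m : w != 0 ->
  dotv (inverse_normal_derivative w e a m) (reflect_along w a) =
    - dotv m a + 2%:R * e / dotv w w * dotv a a.
Proof.
rewrite -dotv_eq0 => w0; rewrite /inverse_normal_derivative /reflect_along.
rewrite !(dotvDl, dotvDr, dotvNl, dotvNr, dotvZl, dotvZr) (dotvC a w).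
by field.
Qed.

End DotCross.

Section DirectionalDerivative.
Context {R : realType} {V : normedModType R}.
Implicit Types (f g : V -> 'rV[R]_3) (h : V -> R) (q d : V).

Lemma derivable_sqrt h q d : 0 < h q -> derivable h q d ->
  derivable (fun y => Num.sqrt (h y)) q d.
Proof.
move=> h0 /derivable1P/derivableP dh; apply/derivable1P.
have ds := @is_derive1_sqrt R (h (0 *: d + q)).
rewrite scale0r add0r in ds; have {}ds := ds h0.
have := @is_derive1_comp _ Num.sqrt (fun t : R => h (t *: d + q)) 0 _ _ _ dh.
by rewrite scale0r add0r => /(_ _ ds)[].
Qed.

Lemma is_derive_coord f q d (df : 'rV[R]_3) i :
  is_derive q d f df -> is_derive q d (fun y => f y 0 i) (df 0 i).
Proof.
move=> [fd <-]; apply: DeriveDef; first exact: (derivable_mxP f q d).1.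
by rewrite derive_mx// mxE.
Qed.

Lemma is_derive_row f q d (df : 'rV[R]_3) :
  (forall i, is_derive q d (fun y => f y 0 i) (df 0 i)) -> is_derive q d f df.
Proof.
move=> fd; have df0 : derivable f q d.
  by apply/derivable_mxP => i j; rewrite ord1; have [] := fd j.
apply: DeriveDef => //; rewrite derive_mx//; apply/rowP => i.
by rewrite mxE; have [] := fd i.
Qed.

Lemma is_derive_scale h f q d (dh : R) (df : 'rV[R]_3) :
  is_derive q d h dh -> is_derive q d f df ->
  is_derive q d (fun y => h y *: f y) (dh *: f q + h q *: df).
Proof.
move=> hd fd; apply: is_derive_row => i.
have fid := is_derive_coord _ _ _ _ i fd.
have -> : (fun y => (h y *: f y) 0 i) = h * (fun y => f y 0 i).
  by apply/funext => y; rewrite mxE.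
by apply: is_derive_eq; rewrite !mxE addrC /GRing.scale/= (mulrC dh).
Qed.

Lemma is_derive_dotv f g q d (df dg : 'rV[R]_3) :
  is_derive q d f df -> is_derive q d g dg ->
  is_derive q d (fun y => dotv (f y) (g y)) (dotv df (g q) + dotv (f q) dg).
Proof.
move=> fd gd.
have fid i := is_derive_coord _ _ _ _ i fd.
have gid i := is_derive_coord _ _ _ _ i gd.
have -> : (fun y => dotv (f y) (g y)) =
    \sum_(i < 3) ((fun y => f y 0 i) * (fun y => g y 0 i)).
  by apply/funext => y; rewrite /dotv fct_sumE.
apply: is_derive_eq; rewrite /dotv -big_split; apply: eq_bigr => i _ /=.
by rewrite /GRing.scale/= addrC (mulrC (df 0 i)).
Qed.

Lemma is_derive_div h (g : V -> R) q d (dh dg : R) :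
  is_derive q d h dh -> is_derive q d g dg -> g q != 0 ->
  is_derive q d (fun y => h y / g y) (dh / g q - h q * dg / g q ^+ 2).
Proof.
move=> hd [gd gE] g0.
have gVd : is_derive q d (fun y => (g y)^-1) (- g q ^- 2 * dg).
  by apply: DeriveDef; [exact: derivableV|rewrite deriveV// gE].
rewrite -[fun y => h y / g y]/(h * (fun y => (g y)^-1)).
by apply: is_derive_eq; rewrite /GRing.scale/=; field.
Qed.

Lemma derivable_crossv f g q d : derivable f q d -> derivable g q d ->
  derivable (fun y => crossv (f y) (g y)) q d.
Proof.
move=> fd gd.
have fid := (derivable_mxP f q d).1 fd 0.
have gid := (derivable_mxP g q d).1 gd 0.
have D i j k l : derivable (fun y => f y 0 i * g y 0 j - f y 0 k * g y 0 l) q d.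
  exact: (derivableB (derivableM (fid i) (gid j)) (derivableM (fid k) (gid l))).
apply/derivable_mxP => i j; rewrite ord1.
have -> : (fun y => crossv (f y) (g y) 0 j) = (fun y =>
  [:: f y 0 1 * g y 0 2%:R - f y 0 2%:R * g y 0 1;
      f y 0 2%:R * g y 0 0 - f y 0 0 * g y 0 2%:R;
      f y 0 0 * g y 0 1 - f y 0 1 * g y 0 0]`_j).
  by apply/funext => y; rewrite mxE.
by case: j => -[|[|[|//]]] ?; apply: D.
Qed.

End DirectionalDerivative.

Section InversePatch.
Context {R : realType} (c : 'rV[R]_3) (r : R).

Lemma inversion_tangent_reflect p (a : 'rV[R]_3) : p != c ->
  inversion_tangent c r p a =
    (r ^+ 2 / dotv (p - c) (p - c)) *: reflect_along (p - c) a.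
Proof.
move=> pc; have := pc; rewrite -subr_eq0 -dotv_eq0 => s0.
rewrite inversion_tangentE// (exprM _ 2 2) enorm_sqr /reflect_along.
by rewrite [RHS]scalerBr scalerA; congr (_ - _ *: _); field.
Qed.

Lemma is_derive_inversion {V : normedModType R} (f : V -> 'rV[R]_3) q d df :
  f q != c -> is_derive q d f df ->
  is_derive q d (inversion c r \o f) (inversion_tangent c r (f q) df).
Proof.
move=> fc fd; have := fc; rewrite -subr_eq0 -dotv_eq0 => s0.
have wd : is_derive q d (fun y => f y - c) df.
  by apply: is_derive_eq (is_deriveB fd (is_derive_cst c q d)) _; rewrite subr0.
have sd := is_derive_dotv _ _ _ _ _ _ wd wd.
have kd := is_derive_div _ _ _ _ _ _ (is_derive_cst (r ^+ 2) q d) sd s0.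
have kwd := is_derive_scale _ _ _ _ _ _ kd wd.
have -> : inversion c r \o f = cst c + (fun y =>
    (cst (r ^+ 2) y / dotv (f y - c) (f y - c)) *: (f y - c)).
  by apply/funext => y; rewrite /inversion/= enorm_sqr.
apply: (is_derive_eq (is_deriveD (is_derive_cst c q d) kwd)).
rewrite add0r inversion_tangentE// (exprM _ 2 2) enorm_sqr (dotvC df) /cst.
rewrite [LHS]addrC -[in RHS]scaleNr; congr (_ + _ *: _).
by field.
Qed.

Implicit Types (x : R * R -> 'rV[R]_3) (q d : R * R).

Lemma partial_inversion x q : x q != c ->
  derivable x q (1, 0) -> derivable x q (0, 1) ->
  partial_u (inversion c r \o x) q = inversion_tangent c r (x q) (partial_u x q) /\
  partial_v (inversion c r \o x) q = inversion_tangent c r (x q) (partial_v x q).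
Proof.
move=> xc /derivableP xu /derivableP xv.
have [_ uE] := is_derive_inversion _ _ _ _ xc xu.
have [_ vE] := is_derive_inversion _ _ _ _ xc xv.
exact: conj uE vE.
Qed.

Lemma unit_normal_inversion x q : 0 < r -> x q != c ->
  derivable x q (1, 0) -> derivable x q (0, 1) ->
  unit_normal (inversion c r \o x) q =
    - unit_normal x q
    + (2%:R * eta c x q / dotv (x q - c) (x q - c)) *: (x q - c).
Proof.
move=> r0 xc xu xv; have := xc; rewrite -subr_eq0 => w0.
have s0 : 0 < dotv (x q - c) (x q - c) by rewrite lt_neqAle eq_sym dotv_eq0 w0 dotv_ge0.
have [uE vE] := partial_inversion _ _ xc xu xv.
have NE := congr2 crossv (etrans uE (inversion_tangent_reflect _ _ xc))
                         (etrans vE (inversion_tangent_reflect _ _ xc)).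
have k0 := divr_gt0 (exprn_gt0 2 r0) s0.
rewrite -[LHS]/((enorm (crossv _ _))^-1 *: crossv _ _) NE.
apply: (etrans (normalize_crossv_reflect _ _ _ _ w0 k0)).
by rewrite -/(unit_normal x q) /reflect_along opprB addrC (dotvC (x q - c)).
Qed.

Lemma derivable_unit_normal x q d :
  crossv (partial_u x q) (partial_v x q) != 0 ->
  derivable (partial_u x) q d -> derivable (partial_v x) q d ->
  derivable (unit_normal x) q d.
Proof.
move=> n0 xu xv; have /derivableP nd := derivable_crossv _ _ _ _ xu xv.
have [nnd _] := is_derive_dotv _ _ _ _ _ _ nd nd.
have ed : derivable (fun y => enorm (crossv (partial_u x y) (partial_v x y))) q d.
  by apply: derivable_sqrt => //; rewrite lt_neqAle eq_sym dotv_eq0 n0 dotv_ge0.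
have /derivableP eVd : derivable
    (fun y => (enorm (crossv (partial_u x y) (partial_v x y)))^-1) q d.
  by apply: derivableV ed; rewrite enorm_eq0.
by have [] := is_derive_scale _ _ _ _ _ _ eVd nd.
Qed.

Lemma is_derive_unit_normal_inversion x q d (dx dU : 'rV[R]_3) : 0 < r ->
  (\near q, [/\ x q != c, derivable x q (1, 0) & derivable x q (0, 1)]) ->
  is_derive q d x dx -> is_derive q d (unit_normal x) dU ->
  dotv (unit_normal x q) dx = 0 ->
  is_derive q d (unit_normal (inversion c r \o x))
    (inverse_normal_derivative (x q - c) (eta c x q) dx dU).
Proof.
move=> r0 nearx xd Ud Uxd; set w := x q - c; pose s := dotv w w.
have [xc _ _] := nbhs_singleton nearx.
have s0 : s != 0 by rewrite dotv_eq0 subr_eq0.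
have wd : is_derive q d (fun y => x y - c) dx.
  by apply: is_derive_eq (is_deriveB xd (is_derive_cst c q d)) _; rewrite subr0.
have sd : is_derive q d (fun y => dotv (x y - c) (x y - c)) (2%:R * dotv w dx).
  apply: is_derive_eq (is_derive_dotv _ _ _ _ _ _ wd wd) _.
  by rewrite (dotvC dx) -mulr2n mulr_natl.
have etad : is_derive q d (eta c x) (dotv dU w).
  apply: is_derive_eq (is_derive_dotv _ _ _ _ _ _ Ud wd) _.
  by rewrite Uxd addr0.
have twoetad : is_derive q d (2%:R \*: eta c x) (2%:R * dotv dU w).
  exact: is_deriveZ.
have kd := is_derive_div _ _ _ _ _ _ twoetad sd s0.
have kwd := is_derive_scale _ _ _ _ _ _ kd wd.
have nearU : \near q, (- unit_normal x + (fun y =>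
      (2%:R * eta c x y / dotv (x y - c) (x y - c)) *: (x y - c))) q
    = unit_normal (inversion c r \o x) q.
  by apply: filterS nearx => y [yc yu yv]; rewrite unit_normal_inversion.
apply: is_derive_eq (near_eq_is_derive nearU (is_deriveD (is_deriveN Ud) kwd)) _.
rewrite /inverse_normal_derivative -[RHS]addrA -/s; congr (- _ + (_ *: _ + _)).
move: s0 => /=; generalize s (eta c x q) (dotv w dx) (dotv dU w) => *.
by rewrite /GRing.scale/=; field.
Qed.

Lemma tangent_planeP x q (a : 'rV[R]_3) :
  reflect (exists k l, a = k *: partial_u x q + l *: partial_v x q)
    (a \in tangent_plane x q).
Proof.
rewrite /tangent_plane span_cons span_seq1; apply: (iffP memv_addP).
  by move=> [_ /vlineP[k ->] [_ /vlineP[l ->] ->]]; exists k, l.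
move=> [k [l ->]]; exists (k *: partial_u x q); first by apply/vlineP; exists k.
by exists (l *: partial_v x q) => //; apply/vlineP; exists l.
Qed.

Lemma shape_operatorE x q k l : crossv (partial_u x q) (partial_v x q) != 0 ->
  shape_operator x q (k *: partial_u x q + l *: partial_v x q) =
    - (k *: partial_u (unit_normal x) q + l *: partial_v (unit_normal x) q).
Proof.
move=> n0; have S0 : shape_operator x q 0 = 0.
  have := shape_operator_linear x q (- 1) 0 0.
  by rewrite scaler0 addr0 scaleN1r addNr.
have Sv : shape_operator x q (l *: partial_v x q)
    = l *: - partial_v (unit_normal x) q.
  have := shape_operator_linear x q l (partial_v x q) 0.
  by rewrite S0 !addr0 => ->; congr (_ *: _); exact: shape_operator_v.
apply: (etrans (shape_operator_linear x q k _ _)).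
apply: (etrans (congr2 +%R (congr1 ( *:%R k) (shape_operator_u n0)) Sv)).
by rewrite !scalerN opprD.
Qed.

Lemma inversion_tangent_comb p k l (a b : 'rV[R]_3) : p != c ->
  inversion_tangent c r p (k *: a + l *: b) =
    k *: inversion_tangent c r p a + l *: inversion_tangent c r p b.
Proof.
move=> pc; rewrite !inversion_tangent_reflect// /reflect_along !(dotvDr, dotvZr).
by apply/rowP => i; rewrite !mxE; ring.
Qed.

Lemma inversion_tangent_eq0 p (a : 'rV[R]_3) : 0 < r -> p != c ->
  (inversion_tangent c r p a == 0) = (a == 0).
Proof.
move=> r0 pc; have := pc; rewrite -subr_eq0 => w0.
rewrite inversion_tangent_reflect// scaler_eq0 reflect_along_eq0//.
by rewrite mulf_eq0 invr_eq0 dotv_eq0 (negbTE w0) expf_eq0 gt_eqF.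
Qed.

Lemma crossv_inversion_tangent p (a b : 'rV[R]_3) : 0 < r -> p != c ->
  crossv a b != 0 ->
  crossv (inversion_tangent c r p a) (inversion_tangent c r p b) != 0.
Proof.
move=> r0 pc n0; have := pc; rewrite -subr_eq0 => w0.
rewrite !inversion_tangent_reflect// crossvZ crossv_reflect// scaler_eq0 oppr_eq0.
rewrite reflect_along_eq0// (negbTE n0) orbF expf_eq0/=.
by rewrite mulf_eq0 invr_eq0 dotv_eq0 (negbTE w0) expf_eq0 gt_eqF.
Qed.

Lemma second_form_inversion x q (a : 'rV[R]_3) : 0 < r ->
  (\near q, [/\ x q != c, derivable x q (1, 0) & derivable x q (0, 1)]) ->
  crossv (partial_u x q) (partial_v x q) != 0 ->
  derivable (unit_normal x) q (1, 0) -> derivable (unit_normal x) q (0, 1) ->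
  a \in tangent_plane x q ->
  let s := dotv (x q - c) (x q - c) in
  let y := inversion c r \o x in
  let b := inversion_tangent c r (x q) a in
  b \in tangent_plane y q /\
  second_form y q b b =
    - (r ^+ 2 / s) * (second_form x q a a + 2%:R * eta c x q / s * first_form a a).
Proof.
move=> r0 nearx n0 Uu Uv /tangent_planeP[k [l aE]] s y b.
have [xc xu xv] := nbhs_singleton nearx.
have [yu yv] := partial_inversion _ _ xc xu xv.
have bE : b = k *: partial_u y q + l *: partial_v y q.
  rewrite /b aE; apply: (etrans (inversion_tangent_comb _ k l _ _ xc)).
  exact: (congr2 +%R (congr1 ( *:%R k) (esym yu)) (congr1 ( *:%R l) (esym yv))).
split; first by apply/tangent_planeP; exists k, l.
have Uxu : dotv (unit_normal x q) (partial_u x q) = 0.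
  by rewrite dotvZl dotv_crossl mulr0.
have Uxv : dotv (unit_normal x q) (partial_v x q) = 0.
  by rewrite dotvZl dotv_crossr mulr0.
have [_ Vu] := is_derive_unit_normal_inversion _ _ _ _ _ r0 nearx
  (derivableP xu) (derivableP Uu) Uxu.
have [_ Vv] := is_derive_unit_normal_inversion _ _ _ _ _ r0 nearx
  (derivableP xv) (derivableP Uv) Uxv.
have ny0 : crossv (partial_u y q) (partial_v y q) != 0.
  by rewrite yu yv; exact: crossv_inversion_tangent.
pose m := k *: partial_u (unit_normal x) q + l *: partial_v (unit_normal x) q.
have SxE : shape_operator x q a = - m by rewrite aE; exact: shape_operatorE.
have SyE : shape_operator y q b =
    - inverse_normal_derivative (x q - c) (eta c x q) a m.
  rewrite bE; apply: (etrans (shape_operatorE _ _ k l ny0)); congr (- _).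
  apply: (etrans (congr2 +%R (congr1 ( *:%R k) Vu) (congr1 ( *:%R l) Vv))).
  by rewrite aE; exact: inverse_normal_derivative_comb.
rewrite /second_form SxE SyE !dotvNl /b (inversion_tangent_reflect _ _ xc) dotvZr.
have w0 : x q - c != 0 by rewrite subr_eq0.
rewrite (dotv_inverse_normal_derivative _ _ _ _ w0).
exact: (esym (mulNr _ _)).
Qed.

End InversePatch.

Theorem lemma4p5 (R : realType) (c : 'rV[R]_3) (r : R) (hr : 0 < r)
    (U : set (R * R)) (x : R * R -> 'rV[R]_3) (hx : regular_patch c U x)
    (u v : R) (huv : U (u, v))
    (a : 'rV[R]_3) (ha : asymptotic_vector x (u, v) a) :
  asymptotic_vector (inversion c r \o x) (u, v)
    (inversion_tangent c r (x (u, v)) a)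
  <-> eta c x (u, v) = 0.
Proof.
case: hx => oU smx xc n0; case: ha => aT a0 ka0.
have [_ [xd [_ [xud _ _]] [_ [xvd _ _]]]] := smx 2.
have [xuu xuv] := xud _ huv; have [xvu xvv] := xvd _ huv.
have near_x : \forall q \near (u, v),
    [/\ x q != c, derivable x q (1, 0) & derivable x q (0, 1)].
  have := open_nbhs_nbhs (conj oU huv); apply: filterS => q Uq.
  by have [? ?] := xd _ Uq; split => //; exact: xc.
have [bT bII] := second_form_inversion _ _ _ _ _ hr near_x (n0 _ huv)
  (derivable_unit_normal _ _ _ (n0 _ huv) xuu xvu)
  (derivable_unit_normal _ _ _ (n0 _ huv) xuv xvv) aT.
have I0 : first_form a a != 0 by rewrite /first_form dotv_eq0.
have IIx : second_form x (u, v) a a = 0.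
  by move/eqP: ka0; rewrite mulf_eq0 invr_eq0 (negbTE I0) orbF => /eqP.
have b0 : inversion_tangent c r (x (u, v)) a != 0.
  by rewrite inversion_tangent_eq0// xc.
have s0 : dotv (x (u, v) - c) (x (u, v) - c) != 0.
  by rewrite dotv_eq0 subr_eq0 xc.
rewrite IIx add0r in bII.
split=> [[_ _ /eqP]|eta0]; last first.
  by split=> //; rewrite /normal_curvature bII eta0 mulr0 !mul0r mulr0 mul0r.
rewrite mulf_eq0 invr_eq0 /first_form dotv_eq0 (negbTE b0) orbF bII.
rewrite !mulf_eq0 oppr_eq0 !mulf_eq0 !invr_eq0 (negbTE s0) (negbTE I0).
by rewrite (gt_eqF hr) pnatr_eq0/= !orbF => /eqP.
Qed.
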